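(* Let $h\in\mathcal{H}$. Then the linear order $\leq_h$ on the rooted compact real tree $(T_h,d_h,\rho_h)$ satisfies (Or1) and (Or2), and the measure $\mu_h$ satisfies (Mes) with respect to $(T_h,d_h,\rho_h,\leq_h)$.
   Context: For $M\geq 0$, $\mathcal{H}_M$ is the set of non-negative functions $h$ on $[0,M]$ that are left-continuous with right-limits and satisfy $h(0)=h(0+)=0$ and $h(t)-h(t+)\geq 0$ for $t\in[0,M)$ (conditions on right-limits are void if $M=0$); $\mathcal{H}=\bigcup_{M\ge 0}\mathcal{H}_M$. For $h\in\mathcal{H}_M$ and $s,t\in[0,M]$ set $d_h(s,t)=h(s)+h(t)-2\inf_{r\in[s\wedge t,s\vee t]}h(r)$ (a pseudo-distance). Let $s\sim_h t$ iff $d_h(s,t)=0$, $T_h=[0,M]/\sim_h$ with the induced distance $d_h$, and $p_h:[0,M]\to T_h$ the canonical projection. $(T_h,d_h)$ is a compact real tree: any two points $\sigma,\sigma'$ are joined by a unique arc, denoted $[\![\sigma,\sigma']\!]$, which is isometric to $[0,d_h(\sigma,\sigma')]$. Set $\rho_h=p_h(0)$ (the root); $\sigma\leq_h\sigma'$ iff $\inf p_h^{-1}(\{\sigma\})\leq\inf p_h^{-1}(\{\sigma'\})$ (a linear order on $T_h$); $\mu_h(A)=\lambda(p_h^{-1}(A))$ for Borel $A\subset T_h$, with $\lambda$ Lebesgue measure on $[0,M]$. For a rooted compact real tree $(T,d,\rho)$ with linear order $\leq$ and finite Borel measure $\mu$: - (Or1): for all $\sigma_1,\sigma_2\in T$,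 if $\sigma_1\in[\![\rho,\sigma_2]\!]$ then $\sigma_1\leq\sigma_2$. - (Or2): if $\sigma_1\leq\sigma_2\leq\sigma_3$, then $\gamma\in[\![\rho,\sigma_2]\!]$, where $\gamma$ is defined by $[\![\rho,\gamma]\!]=[\![\rho,\sigma_1]\!]\cap([\![\rho,\sigma_2]\!]\cup[\![\rho,\sigma_3]\!])$. - (Mes): for all distinct $\sigma_1,\sigma_2\in T$ with $\sigma_1<\sigma_2$, $\mu(\{\sigma\in T:\sigma_1<\sigma<\sigma_2\})>0$. *)

(* Defs.v *)
From HB Require Import structures.
From mathcomp Require Import all_boot all_order all_algebra.
From mathcomp Require Import generic_quotient.
From mathcomp Require Import all_classical all_reals all_analysis.
From mathcomp Require Import measurable_realfun.
From mathcomp Require Import ring lra.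

Set Implicit Arguments.
Unset Strict Implicit.
Unset Printing Implicit Defensive.

Import Order.TTheory GRing.Theory Num.Theory.
Import numFieldNormedType.Exports.

Local Open Scope classical_set_scope.
Local Open Scope ring_scope.

(* An element of H_M is encoded as a total function on R; only its values on
   [0, M] matter, and everything below depends on these values only.
   At an interior point, and at M from the left (resp. at 0 from the right),
   the one-sided limits below only see points of [0, M]. *)
Record coding (R : realType) (M : R) := Coding {
  coding_fun :> R -> R ;
  coding_dom : 0 <= M ;
  coding_ge0 : forall t, t \in `[0, M] -> 0 <= coding_fun t ;
  coding_left_cont : forall t, t \in `]0, M] ->
    coding_fun x @[x --> t^'-] --> coding_fun t ;
  coding_right_lim : forall t, t \in `[0, M[ ->
    cvg (coding_fun x @[x --> t^'+]) ;
  coding_at0 : coding_fun 0 = 0 ;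
  coding_at0r : 0 < M -> lim (coding_fun x @[x --> 0^'+]) = 0 ;
  coding_drop : forall t, t \in `[0, M[ ->
    0 <= coding_fun t - lim (coding_fun x @[x --> t^'+])
}.

Section pseudo_distance.
Context {R : realType}.

Definition infh (h : R -> R) (s t : R) : R :=
  inf (h @` `[Num.min s t, Num.max s t]).

Definition dh (h : R -> R) (s t : R) : R := h s + h t - 2 * infh h s t.

Lemma dhC h s t : dh h s t = dh h t s.
Proof. by rewrite /dh /infh minC maxC [h s + _]addrC. Qed.

Lemma dhxx h t : dh h t t = 0.
Proof.
by rewrite /dh /infh minxx maxxx set_itv1 image_set1 inf1 mulr2n; ring.
Qed.

Context {M : R} (h : coding M).

Lemma between_dom (s t r : R) : s \in `[0, M] -> t \in `[0, M] ->
  r \in `[Num.min s t, Num.max s t] -> r \in `[0, M].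
Proof.
rewrite !in_itv/= => /andP[s0 sM] /andP[t0 tM] /andP[mr rm].
rewrite (le_trans _ mr) ?le_min ?s0// (le_trans rm)//.
by rewrite ge_max sM.
Qed.

Lemma infh_le (s t r : R) : s \in `[0, M] -> t \in `[0, M] ->
  r \in `[Num.min s t, Num.max s t] -> infh h s t <= h r.
Proof.
move=> sM tM rst; apply: ge_inf; last by exists r.
exists 0 => _ [u ust <-]; apply: coding_ge0; exact: between_dom ust.
Qed.

Lemma le_infh (s t m : R) :
  (forall r, r \in `[Num.min s t, Num.max s t] -> m <= h r) ->
  m <= infh h s t.
Proof.
move=> mh; apply: lb_le_inf; last by move=> _ [r rst <-]; apply: mh.
exists (h (Num.min s t)), (Num.min s t) => //=.
by rewrite in_itv/= lexx ge_min le_max lexx.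
Qed.

Lemma dh_ge0 s t : s \in `[0, M] -> t \in `[0, M] -> 0 <= dh h s t.
Proof.
move=> sM tM.
have : infh h s t <= h s.
  by apply: infh_le => //; rewrite in_itv/= ge_min le_max lexx.
have : infh h s t <= h t.
  by apply: infh_le => //; rewrite in_itv/= ge_min le_max lexx !orbT.
by rewrite /dh; lra.
Qed.

Lemma dh_triangle s t u : s \in `[0, M] -> t \in `[0, M] -> u \in `[0, M] ->
  dh h s u <= dh h s t + dh h t u.
Proof.
move=> sM tM uM.
have st : infh h s t <= h t.
  by apply: infh_le => //; rewrite in_itv/= ge_min le_max lexx !orbT.
have tu : infh h t u <= h t.
  by apply: infh_le => //; rewrite in_itv/= ge_min le_max lexx.
suff : infh h s t + infh h t u - h t <= infh h s u by rewrite /dh; lra.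
apply: le_infh => r rsu.
have [rst|rst] := boolP (r \in `[Num.min s t, Num.max s t]).
  by have := infh_le sM tM rst; lra.
suff rtu : r \in `[Num.min t u, Num.max t u].
  by have := infh_le tM uM rtu; lra.
move: rst rsu; rewrite !in_itv/= !ge_min !le_max.
by case: (leP s r); case: (leP u r); case: (leP t r); case: (leP r s);
  case: (leP r u); case: (leP r t) => //=; lra.
Qed.

Definition dom := {t : R | t \in `[0, M]}.

Definition sim : rel dom := fun s t => dh h (val s) (val t) == 0.

Lemma sim_refl : reflexive sim.
Proof. by move=> s; rewrite /sim dhxx. Qed.

Lemma sim_sym : symmetric sim.
Proof. by move=> s t; rewrite /sim dhC. Qed.

Lemma sim_trans : transitive sim.
Proof.
move=> t s u /eqP st /eqP tu; rewrite /sim eq_le; apply/andP; split.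
  have := dh_triangle (valP s) (valP t) (valP u); rewrite st tu addr0; exact.
exact: dh_ge0 (valP s) (valP u).
Qed.

Canonical sim_equiv := EquivRel sim sim_refl sim_sym sim_trans.

End pseudo_distance.

Section coded_tree.
Context {R : realType} {M : R} (h : coding M).
Local Open Scope quotient_scope.

Definition tree := {eq_quot (sim_equiv h)}.
HB.instance Definition _ := Choice.on tree.
HB.instance Definition _ := EqQuotient.on tree.

Definition proj (t : @dom R M) : tree := \pi_tree t.

Lemma projP (s t : @dom R M) : proj s = proj t <-> dh h (val s) (val t) = 0.
Proof.
split; first by move=> /eqmodP/eqP.
by move=> st; apply/eqmodP/eqP.
Qed.

Definition treed (x y : tree) : R := dh h (val (repr x)) (val (repr y)).

Lemma treedE (s t : @dom R M) : treed (proj s) (proj t) = dh h (val s) (val t).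
Proof.
have K (u : @dom R M) : dh h (val (repr (proj u))) (val u) = 0.
  by apply/projP; rewrite /proj reprK.
rewrite /treed; apply/eqP; rewrite eq_le; apply/andP; split.
  apply: le_trans (dh_triangle h (valP _) (valP s) (valP _)) _.
  rewrite K add0r.
  apply: le_trans (dh_triangle h (valP _) (valP t) (valP _)) _.
  by rewrite [dh h (val t) _]dhC K addr0.
apply: le_trans (dh_triangle h (valP _) (valP (repr (proj s))) (valP _)) _.
rewrite [dh h (val s) _]dhC K add0r.
apply: le_trans (dh_triangle h (valP _) (valP (repr (proj t))) (valP _)) _.
by rewrite K addr0.
Qed.

Lemma treedxx x : treed x x = 0.
Proof. exact: dhxx. Qed.

Lemma treed_positivity x y : treed x y = 0 -> x = y.
Proof. by move=> /projP; rewrite /proj !reprK. Qed.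

Lemma treedC x y : treed x y = treed y x.
Proof. exact: dhC. Qed.

Lemma treed_triangle y x z : treed x z <= treed x y + treed y z.
Proof. exact: dh_triangle (valP _) (valP _) (valP _). Qed.

HB.instance Definition _ := @isMetric.Build R tree treed
  treedxx treed_positivity treedC treed_triangle.

Lemma dom0 : 0 \in `[0, M].
Proof. by rewrite in_itv/= lexx coding_dom. Qed.

Definition tree_root : tree := proj (exist _ 0 dom0).

HB.instance Definition _ := isPointed.Build tree tree_root.

Definition tree_first (x : tree) : R := inf [set val t | t in proj @^-1` [set x]].

Definition treele (x y : tree) : Prop := tree_first x <= tree_first y.

End coded_tree.

Arguments treele {R M} h x y.

Section mass.
Context {R : realType} {M : R} (h : coding M).

Definition borel := g_sigma_algebraType (@open (tree h)).

Definition mass (A : set borel) : \bar R :=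
  lebesgue_measure [set val t | t in proj h @^-1` A].

Lemma dh_left_cont (t e : R) : t \in `]0, M] -> 0 < e ->
  exists2 a, 0 <= a < t & forall r, a < r <= t -> dh h t r < e.
Proof.
move=> tM e0; have t0 : 0 < t by move: tM; rewrite in_itv => /andP[].
have e4 : 0 < e / 4 by lra.
have /cvgrPdist_lt/(_ _ e4) := coding_left_cont (c := h) tM.
rewrite near_withinE => /nbhs_ballP[d /= d0 hd].
exists (Num.max 0 (t - d)).
  by rewrite le_max lexx gt_max t0 ltrBlDr ltrDl d0.
move=> r; rewrite gt_max => /andP[/andP[r0 rd] rt].
have near u : r <= u <= t -> `|h t - h u| < e / 4.
  move=> /andP[ru]; rewrite le_eqVlt => /predU1P[->|ut].
    by rewrite subrr normr0.
  by apply: hd => //=; rewrite /ball/= ger0_norm; lra.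
have lo : h t - e / 4 <= infh h t r.
  apply: le_infh => u; rewrite in_itv/= (min_idPr rt) (max_idPl rt).
  by move=> /near; rewrite ltr_norml; lra.
have := near r; rewrite lexx rt ltr_norml => /(_ isT).
by rewrite /dh; lra.
Qed.

Lemma left_open_measurable (A : set R) :
  (forall t, A t -> exists2 a, a < t & `]a, t] `<=` A) -> measurable A.
Proof.
move=> oA.
pose C (q : rat) := [set t | [/\ A t, ~ A^° t, ratr q < t & `]ratr q, t] `<=` A]].
have -> : A = A^° `|` \bigcup_q C q.
  apply/seteqP; split=> [t At|t [/interior_subset//|[q _ []//]]].
  have [iAt|niAt] := pselect (A^° t); [by left|right].
  have [a at_ aA] := oA t At.
  have [q] := rat_in_itvoo at_; rewrite in_itv/= => /andP[aq qt].
  exists q => //; split=> // u; rewrite /= in_itv/= => /andP[qu ut].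
  by apply: aA; rewrite /= in_itv/= ut (lt_trans aq).
apply: measurableU; first by apply: open_measurable; exact: open_interior.
apply: bigcupT_measurable_rat => q.
have sub t u : C q t -> C q u -> t < u -> False.
  move=> [_ niA qt _] [_ _ _ uA] tu; apply: niA.
  have : nbhs t `]ratr q, u[%classic by apply: near_in_itvoo; rewrite in_itv/= qt.
  apply: filterS => r /=; rewrite in_itv/= => /andP[qr ru].
  by apply: uA; rewrite /= in_itv/= qr ltW.
have [->//|/set0P[t Ct]] := eqVneq (C q) set0.
suff -> : C q = [set t] by exact: measurable_set1.
apply/seteqP; split=> [u Cu|u /= ->//].
by case: (ltgtP t u) => // [tu|ut]; exfalso; [exact: sub tu|exact: sub ut].
Qed.

Lemma measurable_proj_open (U : set (tree h)) : open U ->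
  measurable [set val t | t in proj h @^-1` U].
Proof.
move=> oU; set B := [set _ | _ in _].
have -> : B = (B `&` [set 0]) `|` (B `\ 0).
  by rewrite setDE -setIUr setUv setIT.
apply: measurableU.
  have /subset_set1[->//|->] : B `&` [set 0] `<=` [set 0] by move=> ? [].
  exact: measurable_set1.
apply: left_open_measurable => _ [[t Ut <-] /eqP t0].
have tM : val t \in `]0, M].
  by have := valP t; rewrite !in_itv/= lt_neqAle eq_sym t0 => /andP[-> ->].
have := open_nbhs_nbhs (conj oU Ut); rewrite -nbhs_ballE => -[e /= e0 eU].
have [a /andP[a0 at_] ae] := dh_left_cont tM e0.
exists a => // r; rewrite /= in_itv/= => /andP[ar rt].
have rM : r \in `[0, M].
  rewrite in_itv/= (le_trans a0 (ltW ar))/= (le_trans rt)//.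
  by move: tM; rewrite in_itv/= => /andP[].
split; last by apply/eqP; rewrite gt_eqF// (le_lt_trans a0).
exists (exist _ r rM) => //=; apply: eU; rewrite ballEmdist/=.
by rewrite [mdist _ _]treedE/= ae// ar.
Qed.

Lemma measurable_proj (A : set borel) : measurable A ->
  measurable [set val t | t in proj h @^-1` A].
Proof.
pose D : set R := [set val t | t in [set: @dom R M]].
have DE : D = `[0, M]%classic.
  apply/seteqP; split=> [_ [t _ <-]|t tM]; first exact: (valP t).
  by exists (exist _ t tM).
pose G := [set A : set (tree h) |
  measurable [set val t | t in proj h @^-1` A]].
suff sub : <<s @open (tree h) >> `<=` G by move=> /sub.
apply: smallest_sub; first split.
- by rewrite /G/= preimage_set0 image_set0.
- move=> B mB; rewrite /G/= [X in measurable X](_ : _ =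
    D `\` [set val t | t in proj h @^-1` B]).
    by apply: measurableD => //; rewrite DE.
  apply/seteqP; split=> [_ [t nBt <-]|_ [[t _ <-] nBt]].
    by split; [exists t|move=> [u Bu /val_inj ut]; move: Bu; rewrite ut; case: nBt].
  by exists t => //; split=> // Bt; apply: nBt; exists t.
- move=> F mF; rewrite /G/= preimage_bigcup image_bigcup.
  exact: bigcupT_measurable.
- exact: measurable_proj_open.
Qed.

Let mass0 : mass set0 = 0%E.
Proof. by rewrite /mass preimage_set0 image_set0 measure0. Qed.

Let mass_ge0 A : (0 <= mass A)%E.
Proof. exact: measure_ge0. Qed.

Let mass_sigma_additive : semi_sigma_additive mass.
Proof.
move=> F mF tF mUF; rewrite /mass preimage_bigcup image_bigcup.
apply: measure_semi_sigma_additive.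
- by move=> n; exact: measurable_proj.
- apply/trivIsetP => i j _ _ ij; apply/seteqP; split => // _ [[s Fs <-] [t Ft]].
  move=> /val_inj ts; move: Ft; rewrite ts => Ft.
  have ij' := tF i j I I (ex_intro _ (proj h s) (conj Fs Ft)).
  by move: ij; rewrite ij' eqxx.
- by apply: bigcupT_measurable => n; exact: measurable_proj.
Qed.

HB.instance Definition _ := isMeasure.Build _ _ _ mass
  mass0 mass_ge0 mass_sigma_additive.

Let mass_fin : fin_num_fun mass.
Proof.
move=> A mA; apply/fin_numPlt; rewrite (lt_le_trans (ltNyr 0) (mass_ge0 _))/=.
have le : (mass A <= lebesgue_measure (`[0%R, M]%classic : set R))%E.
  apply: le_measure; rewrite ?inE//; first exact: measurable_proj.
  by move=> _ [t _ <-]; exact: (valP t).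
by rewrite (le_lt_trans le)// lebesgue_measure_itv; case: ifP => _; rewrite ltry.
Qed.

HB.instance Definition _ := Measure_isFinite.Build _ _ _ mass mass_fin.

End mass.

Arguments mass {R M} h A.

Section conditions.
Context {R : realType} {T : metricType R}.

(* L = 0 is allowed, so that the degenerate arc from x to x is {x} *)
Definition is_arc (x y : T) (A : set T) : Prop :=
  exists L : R, exists f : R -> T,
    [/\ 0 <= L, {within `[0, L], continuous f}, {in `[0, L] &, injective f},
        f 0 = x /\ f L = y & A = f @` `[0, L]].

(* [[x, y]]: in a real tree there is exactly one A such that is_arc x y A *)
Definition tree_arc (x y : T) : set T := get (is_arc x y).

Variables (rho : T) (le : T -> T -> Prop).

Definition Or1 : Prop := forall s1 s2, tree_arc rho s2 s1 -> le s1 s2.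

Definition Or2 : Prop := forall s1 s2 s3, le s1 s2 -> le s2 s3 ->
  exists2 g,
    unique (fun g' => tree_arc rho g' = tree_arc rho s1 `&` (tree_arc rho s2 `|` tree_arc rho s3)) g
    & tree_arc rho s2 g.

Definition slt (x y : T) : Prop := le x y /\ x <> y.

Definition Mes (mu : set T -> \bar R) : Prop := forall s1 s2, slt s1 s2 ->
  (0 < mu [set s | slt s1 s /\ slt s s2])%E.

End conditions.

(* Main.v *)
Require Import Defs.
From mathcomp Require Import all_boot all_order all_algebra.
From mathcomp Require Import all_classical all_reals all_analysis.
From mathcomp Require Import generic_quotient lra.
Import Order.TTheory GRing.Theory Num.Theory.
Import numFieldNormedType.Exports.
Local Open Scope classical_set_scope.
Local Open Scope ring_scope.

Set Implicit Arguments.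
Unset Strict Implicit.
Unset Printing Implicit Defensive.

(** In the coded tree the distance from the root to [p t] is [h t], and the
    Gromov product of [p s] and [p t] at the root is the infimum of [h] between
    [s] and [t] ([gromov_proj]). Two facts about these quantities give the
    geometry. The infimum over an interval covered by two others dominates the
    smaller of their infima, so the Gromov product is an ultrametric
    ([tree_hyperbolic]). And since [h] is left-continuous and jumps only
    downwards, for every height [a <= h t] the last time [s <= t] at which
    [h s <= a] satisfies [h s = a], and [h >= a] on [[s, t]]
    ([last_passage]); hence [p s] is an ancestor of [p t] at height [a]
    ([tree_geodesic]).

    In any rooted metric space with these two properties, the arcs from the
    root are known: the only arc from the root to [x] is the set of ancestors
    of [x] ([tree_arc_ancestors]). The reason is that an ancestor [z] of [y]
    separates the points that branch off above [z] towards [y] from all the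
    others, so a path from one side to the other must visit [z]
    ([path_through_ancestor]). A path from the root to [x] therefore visits all
    the ancestors of [x], and it would have to visit the same point twice if it
    left the set of ancestors. In (Or2) the two intersections are then initial
    segments of the arc to [s1], and the longer of the two determines [g]
    ([branch_point]).

    The order is read off the first visit times [tree_first x], and those are
    attained ([tree_first_attained]), so comparing points of the tree amounts
    to comparing codes.
    - (Or1): by [last_passage], every code of a point is preceded by a code of
      each of its ancestors.
    - (Or2): for first visit times [t1 <= t2 <= t3], the infimum of [h] over
      [[t1, t3]] is at most the one over [[t1, t2]], so the branch point of
      [s1] with [s2] is the higher one, and it lies on the arc to [s2].
    - (Mes): if [t1 < t2] are first visit times, then [h] goes strictly below
      [h t2] at some time [r] in [[t1, t2]]; otherwise the last passage at
      height [h t2] before [t1] would be an earlier visit of the same point. By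
      left-continuity [h > h r] just before [t2], and the points visited there
      cannot have been visited by time [t1]. So a whole interval of times
      codes points strictly between the two ([codes_between]). *)

(** * Arcs from the root in a hyperbolic rooted space *)

Section arcs_from_root.
Context {R : realType} {T : metricType R}.
Implicit Types (x y z : T).

Lemma lipschitz1_continuous (s : T -> R) :
  (forall x y, s x - s y <= mdist x y) -> continuous s.
Proof.
move=> lip x; apply/cvgrPdist_lt => e e0.
apply/nbhs_ballP; exists e => //= y; rewrite ballEmdist /= => xy.
have yx := lip y x; rewrite metric_sym in yx.
by have := lip x y; rewrite ltr_norml; lra.
Qed.

Context (rho : T).

Definition height x : R := mdist rho x.

Definition gromov x y : R := (height x + height y - mdist x y) / 2.

(** [x] lies metrically between the root and [y]. *)
Definition ancestor x y : Prop := height x + mdist x y = height y.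

(** Gromov 0-hyperbolicity, with the root as base point. *)
Definition hyperbolic : Prop :=
  forall x y z, Num.min (gromov x y) (gromov y z) <= gromov x z.

Definition geodesic_to_root : Prop := forall x b, 0 <= b <= height x ->
  exists2 z, ancestor z x & height z = b.

Lemma gromovC x y : gromov x y = gromov y x.
Proof. by rewrite /gromov [height x + _]addrC metric_sym. Qed.

Lemma gromovxx x : gromov x x = height x.
Proof. by rewrite /gromov mdistxx; lra. Qed.

Lemma gromov_ge0 x y : 0 <= gromov x y.
Proof.
have := metric_triangle x rho y; rewrite (metric_sym x rho) -/(height x) -/(height y).
by rewrite /gromov; lra.
Qed.

Lemma gromov_le x y : gromov x y <= height x.
Proof.
have := metric_triangle rho x y.
by rewrite -/(height x) -/(height y) /gromov; lra.
Qed.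

Lemma ancestorP x y : ancestor x y <-> height x <= gromov x y.
Proof.
have := gromov_le x y; rewrite /ancestor /gromov.
by split; lra.
Qed.

Lemma ancestorxx x : ancestor x x.
Proof. by apply/ancestorP; rewrite gromovxx. Qed.

Lemma ancestor_height x y : ancestor x y -> height x <= height y.
Proof. by rewrite /ancestor; have := mdist_ge0 x y; lra. Qed.

Lemma ancestor_antisym x y : ancestor x y -> ancestor y x -> x = y.
Proof.
rewrite /ancestor (metric_sym y x) => xy yx.
by apply: mdist_positivity; lra.
Qed.

Context (hyp : hyperbolic).

Lemma gromov_trans y x z m :
  m <= gromov x y -> m <= gromov y z -> m <= gromov x z.
Proof. by move=> xy yz; rewrite (le_trans _ (hyp x y z))// le_min xy. Qed.

Lemma ancestor_trans y x z : ancestor x y -> ancestor y z -> ancestor x z.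
Proof.
move=> xy /ancestorP yz; apply/ancestorP; apply: (gromov_trans (y := y)).
  exact/ancestorP.
exact: le_trans (ancestor_height xy) yz.
Qed.

Lemma ancestor_chain x z z' : ancestor z x -> ancestor z' x ->
  height z <= height z' -> ancestor z z'.
Proof.
move=> /ancestorP zx /ancestorP z'x zz'; apply/ancestorP.
apply: gromov_trans zx _; rewrite gromovC; exact: le_trans z'x.
Qed.

Lemma ancestor_inj x z z' : ancestor z x -> ancestor z' x ->
  height z = height z' -> z = z'.
Proof.
by move=> zx z'x zz'; apply: ancestor_antisym; apply: (@ancestor_chain x);
  rewrite ?zz'.
Qed.

(** Points [x] with [gromov x y > height z] are those that branch off from the
    arc to [y] above [z]. Giving the distance to [z] a positive sign on this set
    and a negative one elsewhere yields a 1-Lipschitz function, because any two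
    points on different sides have [z] metrically between them ([cross]); the
    intermediate value theorem applies to it along the path. *)
Lemma path_through_ancestor (f : R -> T) (u v a b : R) y z :
  {within `[u, v], continuous f} -> a \in `[u, v] -> b \in `[u, v] ->
  ancestor z y -> gromov (f a) y <= height z < gromov (f b) y ->
  exists2 c, c \in `[Num.min a b, Num.max a b] & f c = z.
Proof.
move=> cf auv buv zy /andP[fa fb].
pose s x := if gromov x y <= height z then - mdist x z else mdist x z.
have cross x x' : gromov x y <= height z < gromov x' y ->
    mdist x z + mdist x' z <= mdist x x'.
  move=> /andP[xz x'z].
  have zx' : height z <= gromov z x'.
    apply: (gromov_trans (y := y)); first exact/ancestorP.
    by rewrite gromovC ltW.
  have xx' : gromov x x' <= height z.
    rewrite leNgt; apply/negP => lt_xx'.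
    suff : Num.min (gromov x x') (gromov x' y) <= height z.
      by rewrite leNgt lt_min lt_xx' x'z.
    exact: le_trans (hyp _ _ _) xz.
  have : gromov x x' <= gromov x z.
    by apply: (gromov_trans (y := x')); rewrite // (gromovC x' z) (le_trans xx').
  move: zx' ; rewrite /gromov (metric_sym z x'); lra.
have cs : continuous s.
  apply: lipschitz1_continuous => x x'; rewrite /s.
  have := metric_triangle x x' z; have := metric_triangle x' x z.
  rewrite (metric_sym x' x).
  case: (leP (gromov x y)) => xz; case: (leP (gromov x' y)) => x'z; try lra.
    by have := mdist_ge0 x z; have := mdist_ge0 x' z; have := mdist_ge0 x x'; lra.
  have := cross x' x; rewrite x'z xz (metric_sym x' x) => /(_ isT); lra.
have csf : {within `[Num.min a b, Num.max a b], continuous (s \o f)}.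
  have sub : `[Num.min a b, Num.max a b] `<=` `[u, v].
    move=> c; move: auv buv; rewrite /= !in_itv /= ge_min le_max.
    by move=> /andP[? ?] /andP[? ?] /andP[/orP[?|?] /orP[?|?]]; lra.
  move=> c; apply: (@continuous_comp (subspace _) T R f s c); last exact: cs.
  exact: (continuous_subspaceW sub cf).
have ab : Num.min a b <= Num.max a b by rewrite ge_min !le_max lexx.
have sa : s (f a) <= 0 by rewrite /s fa oppr_le0 mdist_ge0.
have sb : 0 <= s (f b) by rewrite /s (lt_geF fb) mdist_ge0.
have [|c cab sc] := @IVT R (s \o f) _ _ 0 ab csf.
  by case: (leP a b) => _ /=; rewrite ge_min le_max sa sb ?orbT.
exists c => //; apply: mdist_positivity; move: sc; rewrite /s /=.
by case: ifP => _ ; lra.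
Qed.

Context (geo : geodesic_to_root).

(** If [f u] were not an ancestor of [x], let [z] be the ancestor of [f u] where
    the arcs to [f u] and to [x] part. Both the part of the path before [u] and
    the part after it join [f u] to a point that is not above [z] towards
    [f u], so both visit [z], against injectivity. *)
Lemma arc_from_root x A : is_arc rho x A -> A = [set z | ancestor z x].
Proof.
move=> [L [f [L0 cf injf [f0 fL] ->]]].
have h0 : height rho = 0 by rewrite /height mdistxx.
have g0 y : gromov (f 0) y <= 0 by rewrite f0 -h0; exact: gromov_le.
have L00 : 0 \in `[0, L] by rewrite in_itv /= lexx.
have LL0 : L \in `[0, L] by rewrite in_itv /= lexx L0.
apply/seteqP; split => [_ [u uL <-]|z zx] /=.
  apply/ancestorP; rewrite leNgt; apply/negP => low.
  have [|z zu hz] := @geo (f u) (gromov (f u) x).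
    by rewrite gromov_ge0 ltW.
  have hz_lt : height z < gromov (f u) (f u) by rewrite gromovxx hz.
  have [|c1 c1u fc1] := path_through_ancestor cf L00 uL zu.
    by rewrite (le_trans (g0 _))// hz gromov_ge0.
  have [|c2 c2u fc2] := path_through_ancestor cf LL0 uL zu.
    by rewrite fL gromovC hz_lt hz lexx.
  move: (uL); rewrite /= in_itv /= => /andP[u0 uleL].
  move: c1u c2u; rewrite !in_itv/= (min_idPl u0) (max_idPr u0).
  rewrite (min_idPr uleL) (max_idPl uleL) => /andP[c10 c1u] /andP[uc2 c2L].
  have c12 : c1 = c2.
    by apply: injf; rewrite ?in_itv /= ?fc1 ?fc2//; lra.
  have cu : c1 = u by lra.
  by move: hz_lt; rewrite gromovxx -fc1 cu ltxx.
have [hzx|hzx] := eqVneq (height z) (height x).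
  by exists L => //; rewrite fL (ancestor_inj zx (ancestorxx x) hzx).
have hz : 0 <= height z by rewrite mdist_ge0.
have hzx' : height z < gromov (f L) x.
  by rewrite fL gromovxx lt_neqAle hzx ancestor_height.
have [|c cL fc] := path_through_ancestor cf L00 LL0 zx.
  by rewrite (le_trans (g0 _)).
by exists c => //; move: cL; rewrite (min_idPl L0) (max_idPr L0).
Qed.

(** The ancestor at each height is unique, and the parametrization by height is
    an isometry. *)
Lemma ancestors_arc x : is_arc rho x [set z | ancestor z x].
Proof.
have /boolp.choice[f fP] : forall b, exists z,
    0 <= b <= height x -> ancestor z x /\ height z = b.
  move=> b; have [hb|] := pselect (0 <= b <= height x); last by exists rho.
  by have [z ? ?] := geo hb; exists z.
have hx : 0 <= height x by exact: mdist_ge0.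
exists (height x), f; split => //.
- apply/subspace_continuousP => a; rewrite /= in_itv/= => /fP[fax fa].
  apply/metricType_numDomainType.cvgrPdist_lt => e e0; rewrite near_withinE.
  apply/nbhs_ballP; exists e => //= b; rewrite /ball /= => abe.
  rewrite in_itv /= => /fP[fbx fb].
  apply: le_lt_trans abe; have [ab|/ltW ba] := leP a b.
    have := ancestor_chain fax fbx; rewrite fa fb => /(_ ab).
    by rewrite /ancestor fa fb ler0_norm; lra.
  have := ancestor_chain fbx fax; rewrite fa fb => /(_ ba).
  by rewrite /ancestor fa fb metric_sym ger0_norm; lra.
- move=> a b; rewrite !in_itv /= => /fP[_ fa] /fP[_ fb] fab.
  by rewrite -fa -fb fab.
- have [|a0 h0] := fP 0; first by rewrite lexx.
  have [|aL hL] := fP (height x); first by rewrite lexx andbT.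
  split; first by apply/esym/mdist_positivity.
  exact: (ancestor_inj aL (ancestorxx x) hL).
apply/seteqP; split => [z /= zx|_ [b + <-] /=]; last first.
  by rewrite /= in_itv /= => /fP[].
have zh : 0 <= height z <= height x.
  by rewrite mdist_ge0 ancestor_height.
have [az hz] := fP _ zh.
by exists (height z); [rewrite /= in_itv | exact: ancestor_inj az zx hz].
Qed.

Lemma tree_arc_ancestors x : tree_arc rho x = [set z | ancestor z x].
Proof.
apply: arc_from_root; apply: (getPex (P := is_arc rho x)).
exists [set z | ancestor z x]; exact: ancestors_arc.
Qed.

(** [g] is the ancestor of [x] at height [gromov x y]: by the assumption on the
    Gromov products, the ancestors common to [x] and [z] do not go beyond that
    height either. *)
Lemma branch_point x y z : gromov x z <= gromov x y ->
  exists2 g,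
    unique (fun g' => tree_arc rho g' =
                      tree_arc rho x `&` (tree_arc rho y `|` tree_arc rho z)) g
    & tree_arc rho y g.
Proof.
move=> xzy; rewrite !tree_arc_ancestors.
have [|g gx hg] := @geo x (gromov x y); first by rewrite gromov_ge0 gromov_le.
have gy : ancestor g y.
  apply/ancestorP; apply: (gromov_trans (y := x)); last by rewrite hg.
  exact/ancestorP.
have common w t : ancestor w x -> ancestor w t -> height w <= gromov x t.
  move=> /ancestorP wx /ancestorP wt.
  by apply: (gromov_trans (y := w)); rewrite // gromovC.
exists g; last by [].
split => [|g']; rewrite tree_arc_ancestors.
  apply/seteqP; split => [w /= wg|w /= [wx wyz]].
    by split; [exact: ancestor_trans gx|left; exact: ancestor_trans gy].
  apply: (ancestor_chain wx gx); rewrite hg.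
  by case: wyz => /(common _ _ wx) // wz; exact: le_trans xzy.
move=> g'E; have sep w :
    ancestor w g' <-> ancestor w x /\ (ancestor w y \/ ancestor w z).
  by move/seteqP: g'E => [h1 h2]; split; [exact: h1|exact: h2].
have [g'x g'yz] := (sep g').1 (ancestorxx g').
apply: (ancestor_antisym); first by apply/sep; split => //; left.
apply: (ancestor_chain g'x gx); rewrite hg.
by case: g'yz => /(common _ _ g'x) // wz; exact: le_trans xzy.
Qed.

End arcs_from_root.

(** * Ancestors in the coded tree *)

Section coded_tree_order.
Context {R : realType} {M : R} (h : coding M).

Lemma ge_right_bound (t u c : R) : 0 <= t -> t < u <= M ->
  (forall r, t < r <= u -> c <= h r) -> c <= h t.
Proof.
move=> t0 /andP[tu uM] ch.
have tM : t \in `[0, M[ by rewrite in_itv /= t0 (lt_le_trans tu).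
have := coding_drop h tM; rewrite subr_ge0; apply: le_trans.
apply: limr_ge; first exact: coding_right_lim.
near=> r; apply: ch; apply/andP; split; near: r; first exact: nbhs_right_gt.
exact: nbhs_right_le.
Unshelve. all: by end_near. Qed.

Local Notation proj := (@Defs.proj R M).
Implicit Types (s t : @dom R M) (x y : tree h).

Lemma code_ge0 t : 0 <= h (val t).
Proof. by rewrite coding_ge0 ?(valP t). Qed.

(** The witness is the supremum of the times up to [t] at which [h <= a]:
    left-continuity gives [h <= a] there, and the absence of upward jumps gives
    [h >= a]. *)
Lemma last_passage t (a : R) : 0 <= a <= h (val t) ->
  exists s, [/\ val s <= val t, h (val s) = a &
    forall r, val s <= r <= val t -> a <= h r].
Proof.
case: t => t /=; rewrite in_itv /= => /andP[t0 tM] /andP[a0 at_].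
pose S := [set s : R | 0 <= s <= t /\ h s <= a].
have S0 : S 0 by rewrite /S/= coding_at0 lexx.
have supS : has_sup S.
  by split; [exists 0|exists t => s [/andP[]]].
have ubS r : S r -> r <= sup S by exact: sup_upper_bound.
have s0 : 0 <= sup S by exact: ubS.
have st : sup S <= t by apply: ge_sup; [exists 0|move=> s [/andP[]]].
have hs : h (sup S) <= a.
  rewrite leNgt; apply/negP => ahs.
  have sgt0 : 0 < sup S.
    rewrite lt_neqAle s0 andbT; apply/eqP => s00.
    by move: ahs; rewrite -s00 coding_at0 ltNge a0.
  have sM : sup S \in `]0, M] by rewrite in_itv /= sgt0 (le_trans st).
  have e0 : 0 < h (sup S) - a by rewrite subr_gt0.
  have /cvgrPdist_lt/(_ _ e0) := coding_left_cont (c := h) sM.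
  rewrite near_withinE => /nbhs_ballP[d /= d0 hd].
  have [r Sr dr] := sup_adherent d0 supS.
  have := ubS _ Sr; rewrite le_eqVlt => /predU1P[rs|rs].
    by move: ahs; rewrite -rs ltNge Sr.2.
  have := hd r; rewrite /ball /= ger0_norm ?subr_ge0; last exact: ltW.
  by rewrite ltrBlDr -ltrBlDl dr rs => /(_ isT isT); have := Sr.2; rewrite ltr_norml; lra.
have above r : sup S < r <= t -> a < h r.
  move=> /andP[sr rt]; rewrite ltNge; apply/negP => hra.
  suff : r <= sup S by rewrite leNgt sr.
  by apply: ubS; split; rewrite // rt andbT (le_trans s0)// ltW.
have sa : h (sup S) = a.
  apply/eqP; rewrite eq_le hs /=.
  move: st; rewrite le_eqVlt => /predU1P[->//|st].
  apply: (ge_right_bound s0 (u := t)); first by rewrite st.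
  by move=> r /above/ltW.
have sM : sup S \in `[0, M] by rewrite in_itv /= s0 (le_trans st).
exists (exist _ (sup S) sM); split=> //= r /andP[].
rewrite le_eqVlt => /predU1P[<- _|sr rt]; first by rewrite sa.
by rewrite ltW// above// sr.
Qed.

Lemma infh_geP (s t : R) (a : R) : s \in `[0, M] -> t \in `[0, M] -> s <= t ->
  (a <= infh h s t) <-> (forall r, s <= r <= t -> a <= h r).
Proof.
move=> sM tM st; split=> [ai r rst|ar].
  apply: le_trans ai _; apply: infh_le => //.
  by rewrite in_itv/= (min_idPl st) (max_idPr st).
by apply: le_infh => r; rewrite in_itv/= (min_idPl st) (max_idPr st); exact: ar.
Qed.

Lemma proj_repr x : proj h (repr x) = x.
Proof. by rewrite /proj reprK. Qed.

Lemma proj_eqP s t : val s <= val t ->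
  proj h s = proj h t <->
  h (val s) = h (val t) /\ forall r, val s <= r <= val t -> h (val s) <= h r.
Proof.
move=> st; have P := infh_geP (h (val s)) (valP s) (valP t) st.
rewrite projP /dh.
have is_ : infh h (val s) (val t) <= h (val s).
  by apply: infh_le; rewrite ?(valP s) ?(valP t)// in_itv /= ge_min le_max lexx.
have it : infh h (val s) (val t) <= h (val t).
  by apply: infh_le; rewrite ?(valP s) ?(valP t)// in_itv /= ge_min le_max lexx !orbT.
split=> [d0|[st' /P is']]; last lra.
by split; [lra|apply/P; lra].
Qed.

Lemma infh0 t : infh h 0 (val t) = 0.
Proof.
have := valP t; rewrite in_itv /= => /andP[t0 tM].
apply/eqP; rewrite eq_le; apply/andP; split.
  rewrite -[leRHS](coding_at0 h); apply: infh_le; rewrite ?(valP t) ?dom0//.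
  by rewrite in_itv /= (min_idPl t0) lexx le_max lexx.
apply/infh_geP; rewrite ?(valP t) ?dom0// => r /andP[r0 rt].
by apply: coding_ge0; rewrite in_itv /= r0 (le_trans rt).
Qed.

Lemma height_proj t : height (tree_root h) (proj h t) = h (val t).
Proof.
rewrite /height [LHS]treedE /= /dh coding_at0 infh0; lra.
Qed.

Lemma gromov_proj s t :
  gromov (tree_root h) (proj h s) (proj h t) = infh h (val s) (val t).
Proof.
by rewrite /gromov !height_proj [mdist _ _]treedE /dh; lra.
Qed.

Lemma tree_hyperbolic : hyperbolic (tree_root h).
Proof.
move=> x y z; rewrite -(proj_repr x) -(proj_repr y) -(proj_repr z).
rewrite !gromov_proj.
move: (repr x) (repr y) (repr z) => {x y z} [s sM] [t tM] [u uM] /=.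
apply: le_infh => r rsu; rewrite ge_min.
have [rst|rst] := boolP (r \in `[Num.min s t, Num.max s t]).
  by rewrite infh_le.
rewrite orbC infh_le//; move: rst rsu; rewrite !in_itv/= !ge_min !le_max.
by case: (leP s r); case: (leP u r); case: (leP t r); case: (leP r s);
  case: (leP r u); case: (leP r t) => //=; lra.
Qed.

Lemma ancestor_proj s t : val s <= val t ->
  (forall r, val s <= r <= val t -> h (val s) <= h r) ->
  ancestor (tree_root h) (proj h s) (proj h t).
Proof.
move=> st hst; apply/ancestorP; rewrite height_proj gromov_proj.
by apply/infh_geP => //; exact: valP.
Qed.

Lemma tree_geodesic : geodesic_to_root (tree_root h).
Proof.
move=> x a; rewrite -(proj_repr x); move: (repr x) => t; rewrite height_proj.
move=> /last_passage[s [st hs above]].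
exists (proj h s); last by rewrite height_proj.
by apply: ancestor_proj => // r; rewrite hs; exact: above.
Qed.

Lemma ancestor_code t x : ancestor (tree_root h) x (proj h t) ->
  exists2 s, proj h s = x & val s <= val t.
Proof.
move=> xt; have : 0 <= height (tree_root h) x <= h (val t).
  by rewrite mdist_ge0 -height_proj; exact: ancestor_height.
move=> /last_passage[s [st hs above]]; exists s => //.
apply: (ancestor_inj tree_hyperbolic _ xt); last by rewrite height_proj.
by apply: ancestor_proj => // r; rewrite hs; exact: above.
Qed.

(** * First visit times and the order *)

Lemma tree_first_le t : tree_first (proj h t) <= val t.
Proof.
apply: ge_inf; last by exists t.
by exists 0 => _ [s _ <-]; have := valP s; rewrite in_itv /= => /andP[].
Qed.

(** A jump of [h] at the infimum does not prevent it from being a code of [x]: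
    just after the infimum [h] is at least the height of [x], hence so it is at
    the infimum itself, and the last passage at that height from there is a code
    of [x] which cannot be smaller. *)
Lemma tree_first_attained x :
  exists2 t : @dom R M, proj h t = x & val t = tree_first x.
Proof.
set F := [set val t | t in proj h @^-1` [set x]].
have xr := proj_repr x; move: (repr x) xr => t tx.
have Ft : F (val t) by exists t.
have F0 : has_inf F.
  split; first by exists (val t).
  by exists 0 => _ [s _ <-]; have := valP s; rewrite in_itv /= => /andP[].
have := valP t; rewrite in_itv /= => /andP[t0 tM].
have first_ge0 : 0 <= tree_first x.
  apply: lb_le_inf; first by exists (val t).
  by move=> _ [s _ <-]; have := valP s; rewrite in_itv /= => /andP[].
have := tree_first_le t; rewrite tx le_eqVlt => /predU1P[->|ft]; first by exists t.
have after r : tree_first x < r <= val t -> h (val t) <= h r.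
  move=> /andP[fr rt]; have e0 : 0 < r - tree_first x by rewrite subr_gt0.
  have [_ [s sx <-]] := inf_adherent e0 F0.
  rewrite -/(tree_first x) addrC subrK => sr.
  have st : val s <= val t by rewrite (le_trans (ltW sr)).
  have [<- above] := (proj_eqP st).1 (etrans sx (esym tx)).
  by apply: above; rewrite ltW.
have firstM : tree_first x \in `[0, M].
  by rewrite in_itv /= first_ge0 (le_trans (ltW ft)).
have at_first : h (val t) <= h (tree_first x).
  by apply: (ge_right_bound first_ge0 (u := val t)); rewrite ?ft.
have [|s [/= sf hs above]] := @last_passage (exist _ (tree_first x) firstM) (h (val t)).
  by rewrite code_ge0.
have sx : proj h s = x.
  rewrite -tx; apply/proj_eqP; first exact: le_trans sf (ltW ft).
  split=> //= r /andP[sr rt]; rewrite hs.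
  have [rf|fr] := leP r (tree_first x); first by rewrite above ?sr.
  by rewrite after ?fr.
by exists s => //; apply/eqP; rewrite eq_le sf /= -sx tree_first_le.
Qed.

Lemma tree_first_inj x y : tree_first x = tree_first y -> x = y.
Proof.
have [s <- <-] := tree_first_attained x; have [t <- <-] := tree_first_attained y.
by move=> /val_inj ->.
Qed.

Lemma slt_first x y : slt (treele h) x y <-> tree_first x < tree_first y.
Proof.
rewrite /slt /treele lt_neqAle; split => [[-> xy]|/andP[xy ->]].
  by rewrite andbT; apply/eqP => /tree_first_inj.
by split=> // xy'; rewrite xy' eqxx in xy.
Qed.

Lemma tree_Or1 : Or1 (tree_root h) (treele h).
Proof.
move=> x y; rewrite (tree_arc_ancestors tree_hyperbolic tree_geodesic) /=.
rewrite /treele; have [t <- <-] := tree_first_attained y.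
by move=> /ancestor_code[s <- st]; apply: le_trans (tree_first_le s) st.
Qed.

Lemma tree_Or2 : Or2 (tree_root h) (treele h).
Proof.
move=> x y z; rewrite /treele => xy yz.
apply: (branch_point tree_hyperbolic tree_geodesic).
move: xy yz; have [s <- <-] := tree_first_attained x.
have [t <- <-] := tree_first_attained y; have [u <- <-] := tree_first_attained z.
move=> st tu; rewrite !gromov_proj; apply/infh_geP; rewrite ?(valP s) ?(valP t)//.
move=> r /andP[sr rt]; apply: infh_le; rewrite ?(valP s) ?(valP u)//.
by rewrite in_itv /= ge_min sr le_max (le_trans rt tu) orbT.
Qed.

(** If [h] stayed above [h t] on [[s, t]], the last passage at height [h t]
    before [s] would be an earlier code of the point coded by [t]. *)
Lemma valley_before s t : val s < val t -> val t = tree_first (proj h t) ->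
  exists2 r, val s <= r <= val t & h r < h (val t).
Proof.
move=> st tfirst; apply: contrapT => noval.
have above r : val s <= r <= val t -> h (val t) <= h r.
  by move=> srt; rewrite leNgt; apply/negP => hr; apply: noval; exists r.
have [|u [us hu ust]] := @last_passage s (h (val t)).
  by rewrite code_ge0 above// lexx ltW.
have ut : proj h u = proj h t.
  apply/proj_eqP; first by rewrite (le_trans us) ?ltW.
  split=> // r /andP[ur rt]; rewrite hu.
  by have [rs|sr] := leP r (val s); [rewrite ust ?ur|rewrite above ?(ltW sr)].
have := tree_first_le u; rewrite ut -tfirst leNgt.
by rewrite (le_lt_trans us st).
Qed.

(** The codes [u] are those just before the first visit [t] of [y], where [h]
    exceeds its value at a time [r] between the first visits of [x] and [y]; a
    point with a code before [r] and another one at [u] would have height at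
    most [h r]. *)
Lemma codes_between x y : slt (treele h) x y ->
  exists a b : R, a < b /\ `]a, b[%classic `<=`
    [set val t | t in
      proj h @^-1` [set z | slt (treele h) x z /\ slt (treele h) z y]].
Proof.
move=> /slt_first; have [s sx sf] := tree_first_attained x.
have [t ty tf] := tree_first_attained y; rewrite -sf -tf => st.
have [|r /andP[sr rt] hr] := valley_before st; first by rewrite ty.
have := valP s; rewrite in_itv /= => /andP[s0 _].
have t_gt0 : 0 < val t by rewrite (le_lt_trans s0).
have := valP t; rewrite in_itv /= => /andP[_ tM].
have {}rt : r < val t.
  by move: rt hr; rewrite le_eqVlt => /predU1P[->|//]; rewrite ltxx.
have tM' : val t \in `]0, M] by rewrite in_itv /= t_gt0.
have e0 : 0 < h (val t) - h r by rewrite subr_gt0.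
have /cvgrPdist_lt/(_ _ e0) := coding_left_cont (c := h) tM'.
rewrite near_withinE => /nbhs_ballP[d /= d0 hd].
exists (Num.max r (val t - d)), (val t).
split=> [|u]; first by rewrite gt_max rt ltrBlDr ltrDl.
rewrite /= in_itv /= gt_max => /andP[/andP[ru du] ut].
have hru : h r < h u.
  have := hd u; rewrite /ball /= ger0_norm ?subr_ge0; last exact: ltW.
  by rewrite ltrBlDr -ltrBlDl du ut => /(_ isT isT); rewrite ltr_norml; lra.
have uM : u \in `[0, M].
  by rewrite in_itv /= (le_trans s0 (le_trans sr (ltW ru))) (le_trans (ltW ut)).
exists (exist _ u uM) => //; split; apply/slt_first; last first.
  by rewrite -tf (le_lt_trans (tree_first_le _)).
have [w wu wf] := tree_first_attained (proj h (exist _ u uM)).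
rewrite -sf -wf ltNge; apply/negP => ws.
have /= wu' : val w <= val (exist _ u uM : @dom R M).
  by rewrite /= (le_trans ws)// (le_trans sr)// ltW.
have [/= hw above] := (@proj_eqP w (exist _ u uM) wu').1 wu.
have : h (val w) <= h r by rewrite above// (le_trans ws)//= ltW.
by rewrite hw leNgt hru.
Qed.

Lemma tree_Mes : Mes (treele h) (mass h : {finite_measure set (borel h) -> \bar R}).
Proof.
move=> x y /codes_between[a [b [ab sub]]].
apply: (@lt_le_trans _ _ (lebesgue_measure `]a, b[%classic)).
  by rewrite lebesgue_measure_itv /= lte_fin ab -EFinD lte_fin subr_gt0.
(* Lebesgue measure is by definition an outer measure, monotone on all sets. *)
exact: le_mu_ext.
Qed.

End coded_tree_order.

Theorem proposition2p3 (R : realType) (M : R) (h : coding M) :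
  [/\ Or1 (tree_root h) (treele h),
      Or2 (tree_root h) (treele h) &
      Mes (treele h) (mass h : {finite_measure set (borel h) -> \bar R})].
Proof. by split; [exact: tree_Or1 | exact: tree_Or2 | exact: tree_Mes]. Qed.
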